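(* There exists an absolute constant $C>0$ such that for all positive integers $n\ge 3$ and all positive integers $r,s$ with $r>s>r/2$, $$A_3(n;r,s)\le n^{C\binom{r}{s}^2\log\binom{r}{s}}.$$
   Context: For a natural number $N$, $[N]=\{1,\dots,N\}$ and $[N]^{(k)}$ denotes the set of $k$-element subsets of $[N]$. A tight monotone path of length $n$ (on $n$ edges) in a $k$-uniform hypergraph on vertex set $[N]$ is determined by vertices $v_1<v_2<\dots<v_{n+k-1}$ in $[N]$ and consists of the $n$ edges $\{v_i,v_{i+1},\dots,v_{i+k-1}\}$, $1\le i\le n$. For positive integers $n\ge k$ and $r>s$, $A_k(n;r,s)$ is the least $N$ such that every coloring of $[N]^{(k)}$ with $r$ colors contains a tight monotone path on $n$ edges whose edges use at most $s$ distinct colors. *)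

(* Defs.v *)
From mathcomp Require Import all_boot.

Set Implicit Arguments.
Unset Strict Implicit.
Unset Printing Implicit Defensive.

(* The vertex set [N] = {1, ..., N} is represented by 'I_N = {0, ..., N - 1}. *)
Notation kset N k := {S : {set 'I_N} | #|S| == k}.

Definition vertex_seq (N k n : nat) : Type := 'I_(n + k - 1) -> 'I_N.

Definition increasing (N k n : nat) (v : vertex_seq N k n) : Prop :=
  forall i j : 'I_(n + k - 1), i < j -> v i < v j.

Definition path_edge (N k n : nat) (v : vertex_seq N k n) (i : 'I_n) :
    {set 'I_N} :=
  [set v j | j : 'I_(n + k - 1) & i <= j < i + k].

Definition path_edges (N k n : nat) (v : vertex_seq N k n) :
    {set {set 'I_N}} :=
  [set path_edge v i | i : 'I_n].

(* When v is increasing, every element of path_edges v has exactly k elements,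
   so the restriction to kset N k discards no edge of the path. *)
Definition path_colors (N k n r : nat) (c : kset N k -> 'I_r)
    (v : vertex_seq N k n) : {set 'I_r} :=
  [set c e | e : kset N k & sval e \in path_edges v].

Definition forces_path (k n r s N : nat) : Prop :=
  forall c : kset N k -> 'I_r,
    exists2 v : vertex_seq N k n, increasing v & #|path_colors c v| <= s.

(* is_A k n r s N means A_k(n; r, s) = N. *)
Definition is_A (k n r s N : nat) : Prop :=
  forces_path k n r s N /\ forall M : nat, forces_path k n r s M -> N <= M.

Lemma card_path_edge (N k n : nat) (v : vertex_seq N k n) (i : 'I_n) :
  increasing v -> #|path_edge v i| = k.
Proof.
move=> vI; rewrite card_imset; last first.
  move=> a b vab; apply/val_inj; case: (ltngtP a b) => // /vI; by rewrite vab ltnn.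
have [k0|k0] := posnP k.
  transitivity 0; last by rewrite k0.
  apply: eq_card0 => j; rewrite !inE [in X in _ < X]k0 addn0.
  by apply/negP => /andP[/leq_ltn_trans h /h]; rewrite ltnn.
have h (t : 'I_k) : i + t < n + k - 1.
  have := ltn_ord i; have := ltn_ord t; case: (k) (t) k0 => // k' t' _ tk iN.
  rewrite addnS subn1 /=; rewrite ltnS in tk.
  by rewrite -addSn leq_add.
rewrite -[RHS]card_ord -(card_imset predT (f := fun t => Ordinal (h t))); last first.
  by move=> a b /(congr1 val) /= /addnI /val_inj.
apply: eq_card => j; rewrite !inE; apply/andP/imsetP => [[ij jk]|[t _ ->]] /=.
  have tk : j - i < k by rewrite ltn_subLR.
  by exists (Ordinal tk) => //; apply: val_inj; rewrite /= subnKC.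
by rewrite leq_addr ltn_add2l.
Qed.

(* Main.v *)
(* Given a coloring of the triples of [N] and an s-set S of colors, let f u v S
   be the length of the longest tight monotone path ending with the pair u < v
   all of whose colors lie in S; if no path of length n uses at most s colors
   then f u v S < n.  For u < v < w the value strictly increases from f u v to
   f v w at every S containing the color of uvw, so f v w S <= f u v S for at
   most 'C(r - 1, s) = (1 - s / r) 'C(r, s) sets S, which is less than half of
   them by a margin since 2 s > r.

   Attach to each v an optimal mixed strategy of the symmetric game on the
   vectors f v w (w > v) with payoff #{S : f v x S <= f v y S}: it guarantees
   (almost) half of the S against every f v y.  Its marginal distribution
   functions, rounded to multiples of 1/(4r), form a code for v taking at most
   (n + 1)^(4 r 'C(r, s)) values.  If u < v had the same code, then f u v would
   be dominated from below on half of the S by the strategy of u, hence nearly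
   so by that of v, contradicting the margin.  The exponent
   O(r 'C(r, s)) suffices because r <= 'C(r, s). *)

Require Import Defs.
From mathcomp Require Import all_boot all_order all_algebra.
From mathcomp Require Import boolp reals sequences exp.
From mathcomp Require Import ring lra zify.
Import Order.TTheory GRing.Theory Num.Theory.
Set Implicit Arguments.
Unset Strict Implicit.
Unset Printing Implicit Defensive.

(** * Counting initial segments and sets avoiding a color *)

Lemma card_down_closed (n : nat) (A : {set 'I_n}) (t : 'I_n) :
  (forall a b : 'I_n, a <= b -> b \in A -> a \in A) -> (t \in A) = (t < #|A|).
Proof.
move=> downA.
have card_lt k : k <= n -> #|[set a : 'I_n | a < k]| = k.
  move=> kn; rewrite -[RHS]card_ord -(card_imset predT (f := widen_ord kn)).
    apply: eq_card => a; rewrite inE; apply/idP/imsetP => [ak|[b _ ->]] //=.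
    by exists (Ordinal ak) => //; apply: val_inj.
  by move=> a b /(congr1 val) /= /val_inj.
apply/idP/idP => [tA|].
  rewrite -[X in X <= _](card_lt t.+1) //.
  apply/subset_leq_card/subsetP => a; rewrite inE ltnS => le_at.
  exact: downA tA.
apply: contraTT => tNA; rewrite -leqNgt -[X in _ <= X](card_lt t (ltnW (ltn_ord t))).
apply/subset_leq_card/subsetP => a aA; rewrite inE ltnNge.
by apply: contra tNA => le_ta; apply: downA aA.
Qed.

Lemma card_draws_avoiding (r s : nat) (c : 'I_r) :
  #|[set S : {set 'I_r} | (#|S| == s) && (c \notin S)]| = 'C(r.-1, s).
Proof.
have <- : #|setT :\ c| = r.-1 by rewrite setTD cardsC1 card_ord.
rewrite -cards_draws; apply: eq_card => S; rewrite !inE andbC.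
by rewrite subsetD1 subsetT.
Qed.

(** * Tight monotone paths, tracked by their last two vertices *)

Section LongestPaths.
Variables (N r : nat) (c : kset N 3 -> 'I_r).

Definition color_in (S : {set 'I_r}) (u v w : 'I_N) : bool :=
  [exists e : kset N 3, (val e == [set u; v; w]) && (c e \in S)].

(** [k] counts edges and [u], [v] are the last two vertices, so [k = 0] leaves only [u < v]. *)
Fixpoint path_ending (S : {set 'I_r}) (k : nat) (u v : 'I_N) : bool :=
  (u < v) && (if k is k'.+1 then
    [exists t : 'I_N, path_ending S k' t u && color_in S t u v] else true).

Lemma path_ending_lt S k u v : path_ending S k u v -> u < v.
Proof. by case: k => [|k] /andP[]. Qed.

Lemma path_ending_seq S k u v : path_ending S k u v ->
  exists w : nat -> 'I_N, [/\ w k = u, w k.+1 = v,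
    forall i, i <= k -> w i < w i.+1 &
    forall i, i < k -> color_in S (w i) (w i.+1) (w i.+2)].
Proof.
elim: k u v => [|k IHk] u v /andP[ltuv].
  by exists (fun i => if i == 0 then u else v); split=> // -[].
move=> /existsP[t /andP[/IHk [w [wk wk1 w_lt w_col]] tuv]].
exists (fun i => if i <= k.+1 then w i else v); split.
- by rewrite leqnn.
- by rewrite ltnn.
- move=> i ik1; rewrite ik1 ltnS; case: (ltngtP i k) ik1 => [lik _|lik|-> _].
  + by rewrite w_lt // ltnW.
  + rewrite leq_eqVlt => /predU1P[->|]; first by rewrite wk1.
    by rewrite ltnS leqNgt lik.
  + by rewrite w_lt.
- move=> i; case: (ltngtP i k) => [lik _|lik|-> _].
  + by rewrite (leqW (ltnW lik)) !ltnS (ltnW lik) lik w_col.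
  + by rewrite ltnS leqNgt lik.
  + by rewrite leqnSn ltnSn ltnn wk wk1.
Qed.

Lemma path_ending_forces S n u v : path_ending S n u v ->
  exists2 p : vertex_seq N 3 n, increasing p & #|path_colors c p| <= #|S|.
Proof.
move=> /path_ending_seq [w [_ _ w_lt w_col]].
have dimE : (n + 3 - 1 = n.+2)%N by rewrite addnS subn1 /= addn2.
exists (fun j => w j) => [i j lij|].
  have jn : j < n.+2 by rewrite -dimE.
  have mono k l : k < l -> l < n.+2 -> w k < w l.
    elim: l => // l IHl; rewrite ltnS leq_eqVlt => /predU1P[->|kl] ln.
      exact: w_lt.
    by apply: ltn_trans (IHl kl (ltnW ln)) (w_lt _ _).
  exact: mono.
apply/subset_leq_card/subsetP => a /imsetP[e]; rewrite inE => /imsetP[i _ eE] ->.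
have /existsP[e' /andP[/eqP e'E e'S]] := w_col i (ltn_ord i).
suff -> : e = e' by [].
apply: val_inj; rewrite e'E; apply: etrans eE _.
have lt_dim k : k <= 2 -> i + k < n + 3 - 1.
  by move=> k2; rewrite dimE -addn2 -addSn leq_add.
apply/setP => x; rewrite !inE; apply/imsetP/idP.
  case=> j; rewrite inE => /andP[ij ji] ->.
  have {}ji : j <= i.+2 by rewrite -ltnS -(addn3 i).
  move: ij ji; rewrite leq_eqVlt => /predU1P[<-|]; first by rewrite eqxx.
  rewrite leq_eqVlt => /predU1P[<-|]; first by rewrite eqxx orbT.
  by move=> h1 h2; have -> : val j = i.+2;
    [apply/eqP; rewrite eqn_leq h2 h1 | rewrite eqxx orbT].
have mem k : k <= 2 -> exists2 j : 'I_(n + 3 - 1),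
    j \in [set j : 'I_(n + 3 - 1) | i <= j < i + 3] & w (i + k) = w j.
  by move=> k2; exists (Ordinal (lt_dim k k2)); rewrite // inE /= leq_addr ltn_add2l.
rewrite -orbA => /or3P[] /eqP ->.
- by have := mem 0 isT; rewrite addn0.
- by have := mem 1 isT; rewrite addn1.
- by have := mem 2 isT; rewrite addn2.
Qed.

(** The type caps the length at [n], which loses nothing when no path in [S] has [n.+1] edges. For
    [u < v] the default [ord0] is itself admissible. *)
Definition longest (n : nat) (S : {set 'I_r}) (u v : 'I_N) : 'I_n.+1 :=
  [arg max_(k > ord0 | path_ending S k u v) (k : nat)].

Lemma longest_lt n S (u v w : 'I_N) :
  (forall x y, ~~ path_ending S n.+1 x y) -> u < v -> v < w ->
  color_in S u v w -> longest n S u v < longest n S v w.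
Proof.
move=> noS uv vw uvw; rewrite /longest.
case: arg_maxnP => [|k kuv _]; first by rewrite /= uv.
have kvw : path_ending S k.+1 v w.
  by rewrite /= vw; apply/existsP; exists u; rewrite kuv.
have kn : k.+1 < n.+1.
  rewrite ltn_neqAle (ltn_ord k) andbT; apply: contraNneq (noS v w) => <-.
  exact: kvw.
case: arg_maxnP => [|l _ l_max]; first by rewrite /= vw.
exact: (l_max (Ordinal kn)).
Qed.

Lemma exists_color_in (u v w : 'I_N) : u < v -> v < w ->
  exists a : 'I_r, forall S : {set 'I_r}, a \in S -> color_in S u v w.
Proof.
move=> uv vw; have uw := ltn_trans uv vw.
have c3 : #|[set u; v; w]| == 3.
  rewrite setUC cardsU1 cards2 !inE.
  by rewrite -!val_eqE /= (ltn_eqF uv) (gtn_eqF uw) (gtn_eqF vw).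
pose e : kset N 3 := exist _ [set u; v; w] c3.
exists (c e) => S aS; apply/existsP; exists e.
by rewrite /= eqxx.
Qed.

End LongestPaths.

(** * Near-optimal strategies in symmetric games *)

Local Open Scope ring_scope.

(** After multiplication by [1 + t] the left side is at most 1, as [1 + t <= expR t], and the right
    side is [1 + t ^+ 3]. *)
Lemma expRN_le_quadratic (R : realType) (t : R) :
  0 <= t -> expR (- t) <= 1 - t + t ^+ 2.
Proof.
move=> t0; have e0 := expR_gt0 (- t).
have ee : expR (- t) * expR t = 1 by rewrite -expRD addNr expR0.
have h : expR (- t) * (1 + t) <= 1.
  by rewrite -[X in _ <= X]ee ler_wpM2l ?expR_ge1Dx ?ltW.
have t3 : 0 <= t ^+ 3 by rewrite exprn_ge0.
rewrite -(@ler_pM2r _ (1 + t)) ?ltr_pwDl //; apply: le_trans h _; lra.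
Qed.

Section Minimax.
Variables (R : realType) (T : finType) (D : {set T}) (M : T -> T -> R).
Hypotheses (M0 : forall x y, 0 <= M x y) (M1 : forall x y, M x y <= 1).
Hypothesis M_sym : forall x y, x \in D -> y \in D -> 1 <= M x y + M y x.

(** Averaging: if both players use [w], the total payoff [Q] is at least half the squared mass, so
    some pure [x] reaches the average. *)
Lemma symmetric_game_response (w : T -> R) :
  (forall y, 0 < w y) -> D != set0 ->
  exists2 x, x \in D &
    (\sum_(y in D) w y) / 2 <= \sum_(y in D) w y * M x y.
Proof.
move=> w0 /set0Pn [x0 x0D]; apply: contrapT => no_x.
set W := \sum_(y in D) w y in no_x *.
pose Q := \sum_(x in D) \sum_(y in D) w x * w y * M x y.
have lt_half x : x \in D -> \sum_(y in D) w y * M x y < W / 2.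
  by move=> xD; rewrite ltNge; apply/negP => h; apply: no_x; exists x.
have QlW : Q < W * (W / 2).
  rewrite mulr_suml; apply: ltr_sum.
    by apply/hasP; exists x0; rewrite ?mem_index_enum.
  move=> x xD; under eq_bigr do rewrite -mulrA.
  by rewrite -mulr_sumr ltr_pM2l // lt_half.
have QE : Q + Q = \sum_(x in D) \sum_(y in D) w x * w y * (M x y + M y x).
  rewrite {2}/Q exchange_big -big_split; apply: eq_bigr => x _.
  by rewrite -big_split; apply: eq_bigr => y _ /=; ring.
have : W * W <= Q + Q.
  rewrite QE mulr_suml; apply: ler_sum => x xD.
  rewrite mulr_sumr; apply: ler_sum => y yD.
  by rewrite ler_peMr ?M_sym // mulr_ge0 ?ltW.
by move: QlW; lra.
Qed.

(* Multiplicative weights: [x] enters [p] as a best response to the weights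
   [expR (- eta * _)], whose total mass then shrinks by a definite factor. *)
Lemma multiplicative_weights (eta : R) (k : nat) :
  0 < eta -> D != set0 ->
  exists p : T -> R, [/\ forall x, 0 <= p x, \sum_(x in D) p x = k%:R &
    \sum_(y in D) expR (- eta * \sum_(x in D) p x * M x y)
      <= #|D|%:R * expR ((eta ^+ 2 - eta / 2) *+ k)].
Proof.
move=> eta0 D0; elim: k => [|k [p [p0 p1 pW]]].
  exists (fun=> 0); split=> //; first by rewrite big1.
  rewrite mulr0n expR0 mulr1 -sum1_card natr_sum; apply: ler_sum => y _.
  by rewrite big1 ?mulr0 ?expR0 // => x _; rewrite mul0r.
set w := fun y => expR (- eta * \sum_(x in D) p x * M x y) in pW.
have [//|a aD ha] := @symmetric_game_response w _ D0.
  by move=> y; exact: expR_gt0.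
have delta_sum (g : T -> R) : \sum_(x in D) (x == a)%:R * g x = g a.
  rewrite (bigD1 a) //= eqxx mul1r big1 ?addr0 // => x /andP[_ /negPf ->].
  by rewrite mul0r.
exists (fun x => p x + (x == a)%:R); split.
- by move=> x; rewrite addr_ge0.
- rewrite big_split /= p1 (eq_bigr (fun x => (x == a)%:R * 1)) ?delta_sum ?natr1 //.
  by move=> x _; rewrite mulr1.
rewrite [_ *+ _.+1]mulrSr expRD mulrA.
apply: (@le_trans _ _ ((\sum_(y in D) w y) * (1 + (eta ^+ 2 - eta / 2)))); last first.
  apply: ler_pM => //; last exact: expR_ge1Dx.
    by apply: sumr_ge0 => y _; rewrite expR_ge0.
  (* Completing the square makes the factor [1 + (eta ^+ 2 - eta / 2)] nonnegative. *)
  have := sqr_ge0 (eta - 4^-1); lra.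
have stepE y : y \in D ->
    expR (- eta * \sum_(x in D) (p x + (x == a)%:R) * M x y)
      <= w y - eta * (w y * M a y) + eta ^+ 2 * w y.
  move=> _; rewrite (eq_bigr (fun x => p x * M x y + (x == a)%:R * M x y)); last first.
    by move=> x _; rewrite mulrDl.
  rewrite big_split /= (delta_sum (fun x => M x y)) mulrDr expRD -/(w y).
  have -> : w y - eta * (w y * M a y) + eta ^+ 2 * w y
     = w y * (1 - eta * M a y + eta ^+ 2) by ring.
  rewrite ler_wpM2l ?expR_ge0 // mulNr.
  apply: le_trans (expRN_le_quadratic _) _; first by rewrite mulr_ge0 // ltW.
  by rewrite lerD2l exprMn ler_piMr ?sqr_ge0 // expr_le1.
apply: (@le_trans _ _ (\sum_(y in D) (w y - eta * (w y * M a y) + eta ^+ 2 * w y))).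
  exact: ler_sum.
rewrite !big_split /= sumrN -!mulr_sumr.
have := ler_wpM2l (ltW eta0) ha; lra.
Qed.

Lemma symmetric_game_strategy (eps : R) :
  0 < eps -> D != set0 ->
  exists p : T -> R, [/\ forall x, 0 <= p x, \sum_(x in D) p x = 1 &
    forall y, y \in D -> 1 / 2 - eps <= \sum_(x in D) p x * M x y].
Proof.
(* Half of [eps] pays for the quadratic term of the weights, the other half for
   [#|D| <= eta ^+ 2 * k]. *)
move=> eps0 D0; pose eta := eps / 2; have eta0 : 0 < eta by rewrite divr_gt0.
pose k := (Num.truncn (#|D|%:R / eta ^+ 2)).+1.
have k0 : 0 < k%:R :> R by rewrite ltr0n.
have kD : #|D|%:R <= eta ^+ 2 * k%:R.
  rewrite mulrC -ler_pdivrMr ?exprn_gt0 //; apply/ltW/truncnS_gt.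
have [p [p0 p1 pW]] := multiplicative_weights k eta0 D0.
exists (fun x => p x / k%:R); split.
- by move=> x; rewrite divr_ge0 // ltW.
- by rewrite -mulr_suml p1 divff // gt_eqF.
move=> y yD; set P := \sum_(x in D) p x * M x y.
have -> : \sum_(x in D) p x / k%:R * M x y = P / k%:R.
  by rewrite mulr_suml; apply: eq_bigr => x _; rewrite mulrAC.
rewrite ler_pdivlMr //.
(* The term of [y] is at most the whole sum, and [#|D| <= expR #|D|] moves the factor into the
   exponent. *)
have h : expR (- eta * P) <= expR (#|D|%:R + (eta ^+ 2 - eta / 2) *+ k).
  apply: le_trans (_ : _ <= \sum_(y in D) expR (- eta * \sum_(x in D) p x * M x y)) _.
    rewrite (bigD1 y) //= lerDl; apply: sumr_ge0 => z _; exact: expR_ge0.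
  apply: le_trans pW _; rewrite expRD ler_wpM2r ?expR_ge0 //.
  by apply: le_trans (expR_ge1Dx _); rewrite lerDr.
move: h; rewrite ler_expR -mulr_natr => h.
rewrite -(ler_pM2l eta0); have -> : eps = eta * 2 by rewrite /eta; field.
lra.
Qed.

End Minimax.

(** * Coding vertices by rounded distribution functions *)

Section ShiftGraph.
Variables (R : realType) (I : finType) (N n r d : nat).
Variable f : 'I_N.+1 -> 'I_N.+1 -> I -> 'I_n.
Hypotheses (r_gt0 : (0 < r)%N) (I_gt0 : (0 < #|I|)%N).
Hypothesis small_d : (2 * (r * d) <= r.-1 * #|I|)%N.
Hypothesis f_lt : forall u v w : 'I_N.+1, (u < v)%N -> (v < w)%N ->
  (#|[set S | f v w S <= f u v S]| <= d)%N.

Let Dom (v : 'I_N.+1) := [set w : 'I_N.+1 | (v < w)%N].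
Let m : R := #|I|%:R.
Let m_gt0 : 0 < m. Proof. by rewrite ltr0n. Qed.

Let payoff v x y : R := #|[set S | (f v x S <= f v y S)%N]|%:R / m.

Let balanced v (p : 'I_N.+1 -> R) :=
  [/\ forall x, 0 <= p x, \sum_(x in Dom v) p x = 1 &
    forall y, y \in Dom v ->
      m * (1 / 2 - (8 * r%:R)^-1) <=
        \sum_(x in Dom v) p x * #|[set S | (f v x S <= f v y S)%N]|%:R].

Lemma exists_balanced_weights (v : 'I_N.+1) :
  exists p : 'I_N.+1 -> R, (v < N)%N -> balanced v p.
Proof.
(* The last vertex has none above it and gets a dummy weight. *)
have [vN|] := ltnP v N; last by exists (fun=> 0).
have D0 : Dom v != set0 by apply/set0Pn; exists ord_max; rewrite inE.
have eps0 : 0 < (8 * r%:R)^-1 :> R by rewrite invr_gt0 mulr_gt0 // ltr0n.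
have [x y|x y|x y _ _|p [p0 p1 pP]] :=
  @symmetric_game_strategy R _ (Dom v) (payoff v) _ _ _ _ eps0 D0.
- by rewrite divr_ge0 // ltW.
- by rewrite ler_pdivrMr // mul1r ler_nat max_card.
(* By totality of [<=], each [S] counts in at least one of the two payoffs. *)
- rewrite -mulrDl ler_pdivlMr // mul1r -natrD ler_nat -cardsUI.
  apply: leq_trans (leq_addr _ _); rewrite -cardsT; apply/subset_leq_card.
  by apply/subsetP => S _; rewrite !inE leq_total.
exists p => _; split=> // y yD; have := ler_wpM2l (ltW m_gt0) (pP y yD).
congr (_ <= _); rewrite mulr_sumr; apply: eq_bigr => x _.
by rewrite mulrCA; congr (_ * _); rewrite mulrC divfK // gt_eqF.
Qed.

Section Codes.
Variable weight : 'I_N.+1 -> 'I_N.+1 -> R.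
Hypothesis weightP : forall v : 'I_N.+1, (v < N)%N -> balanced v (weight v).

Let cdf v S (t : 'I_n) : R := \sum_(x in Dom v) weight v x * (f v x S <= t)%N%:R.

(** Expected payoffs thus depend only on the marginal distribution at each [S], which is all that a
    code records. *)
Lemma sum_cdf (v : 'I_N.+1) (y : I -> 'I_n) : \sum_S cdf v S (y S) =
  \sum_(x in Dom v) weight v x * #|[set S | (f v x S <= y S)%N]|%:R.
Proof.
rewrite exchange_big /=; apply: eq_bigr => x _; rewrite -mulr_sumr -natr_sum.
congr (_ * _%:R); rewrite -sum1_card [RHS]big_mkcond /=; apply: eq_bigr => S _.
by rewrite inE; case: leqP.
Qed.

Let below v S (a : R) := [set t : 'I_n | cdf v S t < a].
(** For [v < N] each [below v S a] is an initial segment, hence determined by its size; the levels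
    [a] are the multiples of [1/(4r)] up to 1. *)
Let code (v : 'I_N.+1) : {ffun I * 'I_(4 * r) -> 'I_n.+1} :=
  [ffun q : I * 'I_(4 * r) => inord #|below v q.1 (q.2.+1%:R / (4 * r%:R))|].

Lemma below_down (v : 'I_N.+1) S a (t t' : 'I_n) : (v < N)%N ->
  (t <= t')%N -> t' \in below v S a -> t \in below v S a.
Proof.
move=> vN tt'; rewrite !inE; apply: le_lt_trans; apply: ler_sum => x _.
have [p0 _ _] := weightP vN; rewrite ler_wpM2l // ler_nat.
by have [h|] := leqP (f v x S) t; rewrite // (leq_trans h tt').
Qed.

Lemma code_cdf (u v : 'I_N.+1) S t : (u < N)%N -> (v < N)%N -> code u = code v ->
  cdf u S t <= cdf v S t + (4 * r%:R)^-1.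
Proof.
move=> uN vN uv; have r0 : 0 < 4 * r%:R :> R by rewrite mulr_gt0 // ltr0n.
have cdf_ge0 : 0 <= cdf v S t.
  by have [p0 _ _] := weightP vN; apply: sumr_ge0 => x _; rewrite mulr_ge0.
have cdf_le1 : cdf u S t <= 1.
  have [p0 <- _] := weightP uN; apply: ler_sum => x _.
  by rewrite ler_piMr // lern1 leq_b1.
pose j := Num.truncn (4 * r%:R * cdf v S t).
have jl : j%:R <= 4 * r%:R * cdf v S t by rewrite truncn_le // mulr_ge0 // ltW.
have ju : 4 * r%:R * cdf v S t < j.+1%:R by exact: truncnS_gt.
(* If [j] is below [4 * r], the next level above [cdf v S t] is recorded in the code; otherwise
   [cdf v S t] is already at least 1. *)
have [jr|jr] := ltnP j (4 * r); last first.
  apply: (le_trans cdf_le1); rewrite -(ler_pM2l r0) mulr1 mulrDr divff ?gt_eqF //.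
  apply: (@le_trans _ _ j%:R); first by rewrite -natrM ler_nat.
  by apply: le_trans jl _; rewrite lerDl.
have card_lt (w : 'I_N.+1) a : (#|below w S a| < n.+1)%N.
  by rewrite ltnS -[X in (_ <= X)%N]card_ord max_card.
have := congr1 (fun g : {ffun _ -> _} => val (g (S, Ordinal jr))) uv.
rewrite !ffunE /= !inordK ?card_lt // => cardE.
have : t \in below v S (j.+1%:R / (4 * r%:R)).
  by rewrite inE ltr_pdivlMr // mulrC.
rewrite card_down_closed; last by move=> *; apply: below_down vN _ _; eassumption.
rewrite -cardE -card_down_closed; last first.
  by move=> *; apply: below_down uN _ _; eassumption.
rewrite inE => /ltW h; apply: le_trans h _.
rewrite ler_pdivrMr // mulrDl mulVf ?gt_eqF // -natr1 lerD2r.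
by rewrite mulrC.
Qed.

(** Both distributions are tested against the vector [f u v]: the strategy of [u] guarantees almost
    half, while [f_lt] allows that of [v] at most [d]. *)
Lemma code_inj (u v : 'I_N.+1) : (u < v)%N -> (v < N)%N -> code u <> code v.
Proof.
move=> uv vN; have uN := ltn_trans uv vN => /(fun h S t => code_cdf S t uN vN h) cdf_le.
have [_ _ /(_ v)] := weightP uN; rewrite inE -sum_cdf => /(_ uv) lo.
have hi : \sum_S cdf v S (f u v S) <= d%:R.
  have [p0 p1 _] := weightP vN; rewrite sum_cdf.
  rewrite (_ : d%:R = \sum_(x in Dom v) weight v x * d%:R); last first.
    by rewrite -mulr_suml p1 mul1r.
  by apply: ler_sum => x; rewrite inE => vx; rewrite ler_wpM2l // ler_nat f_lt.
have : \sum_S cdf u S (f u v S) <= d%:R + m * (4 * r%:R)^-1.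
  apply: (@le_trans _ _ (\sum_S (cdf v S (f u v S) + (4 * r%:R)^-1))).
    by apply: ler_sum.
  by rewrite big_split /= sumr_const [m * _]mulr_natl lerD2r.
move/(le_trans lo).
have r0 : 0 < r%:R :> R by rewrite ltr0n.
(* Relative to [m], [d] is short of one half by [1/(2r)], more than the losses [1/(8r)] of the
   strategy and [1/(4r)] of rounding. *)
have dm : 2 * (r%:R * d%:R) <= (r%:R - 1) * m.
  by rewrite -(natrB _ r_gt0) subn1 -!natrM ler_nat.
have r8 : 0 < 8 * r%:R :> R by rewrite mulr_gt0.
move/(ler_wpM2l (ltW r8)).
have -> : 8 * r%:R * (m * (1 / 2 - (8 * r%:R)^-1)) = 4 * (r%:R * m) - m.
  by field; rewrite gt_eqF.
have -> : 8 * r%:R * (d%:R + m * (4 * r%:R)^-1) = 8 * (r%:R * d%:R) + 2 * m.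
  by field; rewrite gt_eqF.
by have := m_gt0; lra.
Qed.

Lemma shift_graph_bound_of_weights : (N <= n.+1 ^ (#|I| * (4 * r)))%N.
Proof.
have -> : (n.+1 ^ (#|I| * (4 * r)) = #|{ffun I * 'I_(4 * r) -> 'I_n.+1}|)%N.
  by rewrite card_ffun card_prod !card_ord.
rewrite -[X in (X <= _)%N]card_ord.
apply: (@leq_card _ _ (fun v : 'I_N => code (widen_ord (leqnSn N) v))) => u v.
have [uv|vu|/val_inj //] := ltngtP u v.
- by move=> h; case: (@code_inj (widen_ord (leqnSn N) u) (widen_ord (leqnSn N) v)) => /=.
- by move=> h; case: (@code_inj (widen_ord (leqnSn N) v) (widen_ord (leqnSn N) u)) => /=.
Qed.

End Codes.

Lemma shift_graph_bound : (N <= n.+1 ^ (#|I| * (4 * r)))%N.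
Proof.
have [weight weightP] := choice exists_balanced_weights.
exact: shift_graph_bound_of_weights weightP.
Qed.

End ShiftGraph.

(** * From codes to the bound for triples *)

Lemma leq_bin (r s : nat) : (0 < s < r)%N -> (r <= 'C(r, s))%N.
Proof.
elim: r s => // r IHr [//|s] /=; rewrite ltnS leq_eqVlt => /predU1P[<-|sr].
  by rewrite binSn.
rewrite binS -addn1 leq_add ?bin_gt0 ?IHr //; exact: ltnW (ltnW sr).
Qed.

Lemma forces_path_bound (R : realType) (n r s : nat) :
  (0 < n)%N -> (s < r)%N -> (r < 2 * s)%N ->
  forces_path 3 n r s (n.+1 ^ ('C(r, s) * (4 * r))).+2.
Proof.
case: n => // n _ sr rs c; set K := (_ ^ _)%N in c *; apply: contrapT => no_path.
pose I : finType := {S : {set 'I_r} | #|S| == s}.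
have cardI : #|I| = 'C(r, s).
  by rewrite card_sig -cardsE card_draws card_ord.
have noP (S : I) x y : ~~ path_ending c (val S) n.+1 x y.
  apply/negP => /path_ending_forces [v v_inc]; rewrite (eqP (valP S)) => v_card.
  by apply: no_path; exists v.
pose f u v (S : I) := longest c n (val S) u v.
(* Of the [K.+2] vertices all but the last have distinct codes, and there are only [K] codes. *)
suff : (K.+1 <= K)%N by rewrite ltnn.
rewrite {2}/K -cardI.
apply: (@shift_graph_bound R I K.+1 n.+1 r 'C(r.-1, s) f).
- exact: leq_trans sr.
- by rewrite cardI bin_gt0 ltnW.
(* As [r * 'C(r.-1, s) = (r - s) * 'C(r, s)], it remains that [2 * (r - s) <= r.-1], which is
   [r < 2 * s]. *)
- rewrite cardI mul_bin_down mulnA leq_mul2r; apply/orP; right; lia.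
move=> u v w uv vw; have [a aP] := exists_color_in c uv vw.
rewrite -(card_draws_avoiding s a) -(card_imset _ val_inj).
apply/subset_leq_card/subsetP => T /imsetP[S]; rewrite inE => fS ->.
rewrite inE (valP S) /=; apply: contraL fS => /aP aS.
by rewrite -ltnNge longest_lt.
Qed.

Theorem theorem1p5 (R : realType) :
  exists2 C : R, 0 < C &
    forall n r s : nat,
      (3 <= n)%N -> (0 < r)%N -> (0 < s)%N -> (s < r)%N -> (r < 2 * s)%N ->
      exists2 N : nat, is_A 3 n r s N &
        N%:R <= n%:R `^ (C * 'C(r, s)%:R ^+ 2 * ln 'C(r, s)%:R).
Proof.
have ln2 : 0 < ln 2 :> R by rewrite ln_gt0 ?ltr1n.
(* The integer exponent will be [9 * m ^ 2] with [m = 'C(r, s) >= 2], so [ln m / ln 2 >= 1] supplies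
   the logarithm. *)
exists (9 / ln 2) => [|n r s n3 r0 s0 sr rs]; first by rewrite divr_gt0.
have n0 : (0 < n)%N by apply: leq_trans n3.
set m := 'C(r, s); have rm : (r <= m)%N by rewrite leq_bin // s0.
have m2 : (2 <= m)%N by apply: leq_trans rm; lia.
have /asboolP forced := forces_path_bound R n0 sr rs.
pose forcing N := `[< forces_path 3 n r s N >].
have [N /asboolP N_forces N_min] := ex_minnP (ex_intro forcing _ forced).
exists N; first by split=> // M /asboolP; exact: N_min.
have N_le : (N <= n ^ (9 * m ^ 2))%N.
  apply: leq_trans (N_min _ forced) _.
  (* With [n.+1 <= n ^ 2] and [r <= m] the power is at most [n ^ (8 * m ^ 2)]; the spare factor
     [n >= 3] absorbs the additive 2. *)
  apply: (@leq_trans (n * n ^ (8 * m ^ 2))); last first.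
    rewrite -expnS leq_pexp2l // -/m; have : (0 < m ^ 2)%N by rewrite expn_gt0; lia.
    lia.
  have : ((n.+1 ^ (m * (4 * r))) <= n ^ (8 * m ^ 2))%N.
    apply: (@leq_trans ((n ^ 2) ^ (m * (4 * r)))).
      rewrite leq_exp2r; [nia|lia].
    rewrite -expnM leq_pexp2l //; nia.
  have : (0 < n ^ (8 * m ^ 2))%N by rewrite expn_gt0 n0.
  rewrite -/m; nia.
apply: (@le_trans _ _ (n%:R ^+ (9 * m ^ 2))); first by rewrite -natrX ler_nat.
rewrite -[leLHS]powR_mulrn ?ler0n //; apply: ler_powR; first by rewrite ler1n.
have ln_m : ln 2 <= ln m%:R :> R by rewrite ler_ln ?posrE ?ltr0n ?ler_nat //; lia.
rewrite natrM natrX -[9 / _ * _ * _]mulrA [9 / _ * _]mulrAC.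
rewrite -[9 * (_ * _) / _]mulrA ler_wpM2l // -[_ * _ / _]mulrA ler_peMr ?sqr_ge0 //.
by rewrite ler_pdivlMr // mul1r.
Qed.
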